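(* Let $b\in[n]$. The expected smoothness constant $\mathcal{L}=\mathcal{L}(b)$ of $b$-nice sampling satisfies $$\mathcal{L} \;\le\; \mathcal{L}_{\mathrm{Bernstein}}(b) := 2\,\frac{b-1}{b}\,\frac{n}{n-1}\,L + \frac{1}{b}\left(\frac{n-b}{n-1}+\frac{4}{3}\log d\right)L_{\max},$$ where $\log$ is the natural logarithm.
   Context: Let $n\ge 2$ and $d\ge 1$ be integers, $[n]=\{1,\dots,n\}$, let $a_1,\dots,a_n\in\mathbb{R}^d$, and let $U\ge 0$. (These come from a generalized linear model $f(w)=\frac1n\sum_{i=1}^n\phi_i(a_i^\top w)+\frac{\lambda}{2}\|w\|_2^2$ with convex $\phi_i$ satisfying $\phi_i''\le U$.) For nonempty $B\subseteq[n]$ define the subsample smoothness constant $$L_B:=\frac{U}{|B|}\lambda_{\max}\Big(\sum_{j\in B}a_ja_j^\top\Big),$$ where $\lambda_{\max}$ is the largest eigenvalue. Set $L_i:=L_{\{i\}}=U\|a_i\|_2^2$, $L_{\max}:=\max_{i\in[n]}L_i$, and $L:=L_{[n]}=\frac{U}{n}\lambda_{\max}\big(\sum_{j=1}^na_ja_j^\top\big)$. A $b$-nice sampling is a random subset of $[n]$ uniformly distributed over all subsets of size $b$; its expected smoothness constant is $$\mathcal{L}:=\frac{1}{\binom{n-1}{b-1}}\max_{i\in[n]}\ \sum_{B\subseteq[n]:\,|B|=b,\ i\in B}L_B.$$ *)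

(* Defs.v *)
From mathcomp Require Import all_boot all_order all_algebra.
From mathcomp Require Import all_classical all_reals all_analysis.

Set Implicit Arguments.
Unset Strict Implicit.
Unset Printing Implicit Defensive.

Import Order.TTheory GRing.Theory Num.Theory.

Local Open Scope classical_set_scope.
Local Open Scope ring_scope.

(* For 0 < d and A symmetric, the set below is finite and nonempty, so its
   supremum is attained: it is the largest eigenvalue. *)
Definition lambda_max (R : realType) (d : nat) (A : 'M[R]_d) : R :=
  sup [set x : R | eigenvalue A x].

(* L_B; meaningful for B nonempty. *)
Definition subsample_smoothness (R : realType) (n d : nat)
    (a : 'I_n -> 'cV[R]_d) (U : R) (B : {set 'I_n}) : R :=
  U / #|B|%:R * lambda_max (\sum_(j in B) a j *m (a j)^T).

(* L = L_[n] *)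
Definition full_smoothness (R : realType) (n d : nat)
    (a : 'I_n -> 'cV[R]_d) (U : R) : R :=
  subsample_smoothness a U [set: 'I_n]%SET.

(* L_max = max_i L_{i}. The default value 0 of the iterated maximum is
   immaterial, here and below: the L_B are nonnegative when 0 <= U, and the
   index set is nonempty when 0 < n. *)
Definition max_smoothness (R : realType) (n d : nat)
    (a : 'I_n -> 'cV[R]_d) (U : R) : R :=
  \big[Num.max/0]_(i < n) subsample_smoothness a U [set i]%SET.

(* Expected smoothness constant of b-nice sampling. *)
Definition expected_smoothness (R : realType) (n d : nat)
    (a : 'I_n -> 'cV[R]_d) (U : R) (b : nat) : R :=
  ('C(n.-1, b.-1)%:R)^-1 *
  \big[Num.max/0]_(i < n)
    \sum_(B : {set 'I_n} | (#|B| == b) && (i \in B)) subsample_smoothness a U B.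

Definition bernstein_bound (R : realType) (n d : nat)
    (a : 'I_n -> 'cV[R]_d) (U : R) (b : nat) : R :=
  2 * ((b%:R - 1) / b%:R) * (n%:R / (n%:R - 1)) * full_smoothness a U
  + b%:R^-1 * ((n%:R - b%:R) / (n%:R - 1) + 4 / 3 * ln d%:R)
    * max_smoothness a U.

(* Main.v *)
(* Fix [i] and let [S] be a uniformly random [k]-subset of the other indices,
   [k = b - 1].  Splitting [sum_(j in S) a_j a_j^T] into its mean and a centered
   part, the mean together with [a_i a_i^T] contributes the terms with
   [(n - b) / (n - 1) L_max] and one copy of [(b - 1) / b n / (n - 1) L]; the
   centered part is handled by a matrix Bernstein inequality for sampling
   without replacement.

   The potential is [tr exp].  One more draw multiplies its average by at most
   [1 + s L / (n - 1)]: by the Golden-Thompson inequality it suffices to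
   bound the average of [exp Y] for one centered rank-one matrix [Y <= 3/4], and
   [e^y <= 1 + y + 4/3 y^2] for [y <= 3/4].  That the draw may be made with
   replacement follows from midpoint convexity of [tr exp]: for [u] and [z] in
   a [k.+1]-subset [S], the sum over [S] is the midpoint of the sums where [u] is
   replaced by a copy of [z], and [z] by a copy of [u].

   Golden-Thompson is obtained from
   [tr ((A B)^(2^p)) <= tr (A^(2^p) B^(2^p))] and the limit
   [(1 + A / N)^N --> exp A]. *)
Require Import Defs.
From mathcomp Require Import all_boot all_order all_algebra.
From mathcomp Require Import all_classical all_reals all_analysis.
From mathcomp Require Import ring lra.

Import Order.TTheory GRing.Theory Num.Theory.
Import numFieldNormedType.Exports.

Set Implicit Arguments.
Unset Strict Implicit.
Unset Printing Implicit Defensive.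

Local Open Scope ring_scope.

(** * Euclidean inner product on row vectors *)

Section Dot.
Context {R : realType} {d : nat}.
Implicit Types (x y z : 'rV[R]_d) (A : 'M[R]_d).

Definition dot x y : R := (x *m y^T) 0 0.

Lemma dotE x y : dot x y = \sum_j x 0 j * y 0 j.
Proof. by rewrite /dot mxE; apply: eq_bigr => j _; rewrite mxE. Qed.

Lemma dot_mx x y : x *m y^T = (dot x y)%:M.
Proof. by rewrite [LHS]mx11_scalar. Qed.

Lemma dotC x y : dot x y = dot y x.
Proof. by rewrite !dotE; apply: eq_bigr => j _; rewrite mulrC. Qed.

Lemma dotDl x y z : dot (x + y) z = dot x z + dot y z.
Proof. by rewrite /dot mulmxDl mxE. Qed.

Lemma dotZl c x y : dot (c *: x) y = c * dot x y.
Proof. by rewrite /dot -scalemxAl mxE. Qed.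

Lemma dotDr x y z : dot z (x + y) = dot z x + dot z y.
Proof. by rewrite dotC dotDl !(dotC z). Qed.

Lemma dotZr c x y : dot y (c *: x) = c * dot y x.
Proof. by rewrite dotC dotZl dotC. Qed.

Lemma dot0l x : dot 0 x = 0.
Proof. by rewrite /dot mul0mx mxE. Qed.

Lemma dot_suml (I : Type) (s : seq I) (P : pred I) (F : I -> 'rV[R]_d) y :
  dot (\sum_(i <- s | P i) F i) y = \sum_(i <- s | P i) dot (F i) y.
Proof. by rewrite /dot mulmx_suml summxE. Qed.

Lemma dot_mull A x y : dot (x *m A) y = dot x (y *m A^T).
Proof. by rewrite /dot trmx_mul trmxK mulmxA. Qed.

Lemma dot_ge0 x : 0 <= dot x x.
Proof. by rewrite dotE; apply: sumr_ge0 => j _; rewrite -expr2 sqr_ge0. Qed.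

Lemma dot_eq0 x : (dot x x == 0) = (x == 0).
Proof.
apply/idP/idP => [|/eqP->]; last by rewrite dot0l.
rewrite dotE psumr_eq0 => [/allP h|j _]; last by rewrite -expr2 sqr_ge0.
apply/eqP/rowP => j; have := h j (mem_index_enum _).
by rewrite mulf_eq0 orbb mxE => /eqP.
Qed.

Lemma dot_gt0 x : x != 0 -> 0 < dot x x.
Proof. by move=> x0; rewrite lt_def dot_eq0 x0 dot_ge0. Qed.

Lemma dot_normalize x : x != 0 ->
  dot ((Num.sqrt (dot x x))^-1 *: x) ((Num.sqrt (dot x x))^-1 *: x) = 1.
Proof.
move=> /dot_gt0 x0; rewrite dotZl dotZr mulrA -expr2 exprVn sqr_sqrtr ?ltW//.
by rewrite mulVf// gt_eqF.
Qed.

End Dot.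

(** * Spectral theorem for real symmetric matrices *)

Section Spectral.
Local Open Scope classical_set_scope.
Context {R : realType} {d : nat}.
Implicit Types (x y z : 'rV[R]_d) (A : 'M[R]_d).

Lemma continuous_dot_mul A : continuous (fun x => dot (x *m A) x).
Proof.
have -> : (fun x => dot (x *m A) x) =
    (fun x => \sum_j (\sum_i x 0 i * A i j) * x 0 j).
  by apply/funext => x; rewrite dotE; apply: eq_bigr => j _; rewrite mxE.
have add_cont : continuous (fun x : R * R => x.1 + x.2).
  exact: add_continuous.
refine (@continuous_big _ _ _ 0 xpredT add_cont _ _ _ _) => j _ x.
apply: cvgM; [exact: nbhs_filter| |exact: coord_continuous].
refine (@cvg_big _ _ _ 0 xpredT add_cont _ _ _ _ _ _ _) => [|i _].
  exact: nbhs_filter.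
apply: cvgM; [exact: nbhs_filter|exact: coord_continuous|].
exact: (@cvg_cst _ _ _ (nbhs x)).
Qed.

(** The kernel is the zero set of the quadratic form of [B *m B^T], whose value at [x] is the
    squared norm of [x *m B]; that form is continuous. *)
Lemma closed_kernel k (B : 'M[R]_(d, k)) :
  closed [set x : 'rV[R]_d | x *m B = 0].
Proof.
have -> : [set x : 'rV[R]_d | x *m B = 0] =
    [set x | dot (x *m (B *m B^T)) x = 0].
  have dotB x : dot (x *m (B *m B^T)) x = dot (x *m B) (x *m B).
    by rewrite /dot trmx_mul !mulmxA.
  apply/seteqP; split => x /=; rewrite dotB; first by move=> ->; rewrite dot0l.
  by move/eqP; rewrite dot_eq0 => /eqP.
apply: (@closed_comp _ _ (fun x => dot (x *m (B *m B^T)) x) [set 0]).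
  by move=> x _; exact: continuous_dot_mul.
exact: closed_eq.
Qed.

Lemma compact_sphere : compact [set x : 'rV[R]_d | dot x x = 1].
Proof.
apply: bounded_closed_compact.
  exists 1; split => // M M1 x /= x1.
  rewrite [leLHS]/Num.Def.normr/= mx_normrE; apply: bigmax_le => [|[i j] _ /=].
    by rewrite (le_trans _ (ltW M1)).
  apply: le_trans (ltW M1); rewrite -(@expr_le1 _ 2)//.
  rewrite ord1 real_normK ?num_real// -x1 dotE (bigD1 j)//= -expr2.
  by rewrite lerDl sumr_ge0// => l _; rewrite -expr2 sqr_ge0.
have -> : [set x : 'rV[R]_d | dot x x = 1] =
    (fun x => dot (x *m 1%:M) x) @^-1` [set 1].
  by apply/seteqP; split => x /=; rewrite mulmx1.
apply: closed_comp; first by move=> x _; exact: continuous_dot_mul.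
exact: closed_eq.
Qed.

(** First-order optimality in algebraic form: near [t = 0] a nonzero linear term cannot stay below a
    quadratic one. The value [t = w / (K + 1)] already exhibits this. *)
Lemma quadratic_domination_eq0 (w K : R) : 0 <= w -> 0 <= K ->
  (forall t, 2 * t * w <= t ^+ 2 * K) -> w = 0.
Proof.
move=> w0 K0 /(_ (w / (K + 1))); rewrite -subr_ge0.
have -> : (w / (K + 1)) ^+ 2 * K - 2 * (w / (K + 1)) * w =
   - (w ^+ 2 * ((K + 2) / (K + 1) ^+ 2)) by field; lra.
rewrite oppr_ge0 pmulr_lle0 ?divr_gt0 ?exprn_gt0//; [|lra..].
by move=> h; apply/eqP; rewrite -sqrf_eq0 eq_le h sqr_ge0.
Qed.

(* A maximizer of the Rayleigh quotient on the orthogonal complement of the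
   eigenvectors already found is a further eigenvector. *)
Lemma orthogonal_eigenvector k A (Q : 'M[R]_(k, d)) (D : 'rV[R]_k) :
  A^T = A -> (k < d)%N -> Q *m A = diag_mx D *m Q ->
  exists x mu, [/\ dot x x = 1, x *m Q^T = 0 & x *m A = mu *: x].
Proof.
move=> sA kd QA.
pose V := [set x : 'rV[R]_d | x *m Q^T = 0] `&` [set x | dot x x = 1].
have V0 : V !=set0.
  have /rowV0Pn[v /sub_kermxP vQ v0] : kermx Q^T != 0.
    by rewrite kermx_eq0 /row_free neq_ltn (leq_ltn_trans (rank_leq_col _)).
  exists ((Num.sqrt (dot v v))^-1 *: v); split => /=.
    by rewrite -scalemxAl vQ scaler0.
  exact: dot_normalize.
have cV : compact V.
  by rewrite /V setIC; apply: compact_closedI;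
    [exact: compact_sphere|exact: closed_kernel].
have cf : {within V, continuous (fun x => dot (x *m A) x)}.
  exact/continuous_subspaceT/continuous_dot_mul.
have [x /set_mem[/= xQ x1] xmax] := EVT_max_rV V0 cV cf.
pose mu := dot (x *m A) x; exists x, mu; split => //.
have max y : y *m Q^T = 0 -> dot (y *m A) y <= mu * dot y y.
  move=> yQ; have [->|y0] := eqVneq y 0; first by rewrite mul0mx dot0l mulr0.
  have := xmax ((Num.sqrt (dot y y))^-1 *: y); rewrite inE => /(_ _) h.
  have /h : V ((Num.sqrt (dot y y))^-1 *: y).
    by split => /=; [rewrite -scalemxAl yQ scaler0|exact: dot_normalize].
  rewrite -scalemxAl dotZl dotZr mulrA -expr2 exprVn sqr_sqrtr ?dot_ge0//.
  by rewrite -/mu ler_pdivrMl ?dot_gt0// mulrC.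
(* The residual [y] stays orthogonal to the rows of [Q], since their span is invariant under [A]. So
   [x + t *: y] competes with the maximizer [x] for every [t], which forces [y = 0]. *)
have [y yE] : exists y, y = x *m A - mu *: x by eexists.
have yQ : y *m Q^T = 0.
  rewrite yE mulmxBl -scalemxAl xQ scaler0 subr0 -mulmxA -[A in LHS]sA.
  by rewrite -trmx_mul QA trmx_mul mulmxA xQ mul0mx.
have xAE : x *m A = y + mu *: x by rewrite yE subrK.
have xy : dot x y = 0.
  by rewrite dotC yE -scaleN1r dotDl dotZl dotZl x1 -/mu mulr1 mulN1r subrr.
have yAx : dot (y *m A) x = dot y y.
  by rewrite dot_mull sA xAE dotDr dotZr (dotC y x) xy mulr0 addr0.
have [K KE] : exists K, K = mu * dot y y - dot (y *m A) y by eexists.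
have K0 : 0 <= K by rewrite KE subr_ge0 max.
have key t : 2 * t * dot y y <= t ^+ 2 * K.
  have /max : (x + t *: y) *m Q^T = 0.
    by rewrite mulmxDl -scalemxAl xQ yQ scaler0 addr0.
  rewrite mulmxDl -scalemxAl !(dotDl, dotDr, dotZl, dotZr) (dotC y x) xy x1 yAx.
  rewrite -/mu xAE dotDl dotZl xy KE; lra.
have /eqP := quadratic_domination_eq0 (dot_ge0 y) K0 key.
by rewrite dot_eq0 yE subr_eq0 => /eqP.
Qed.

Lemma orthonormal_eigenvectors k A : A^T = A -> (k <= d)%N ->
  exists (Q : 'M[R]_(k, d)) D, Q *m Q^T = 1%:M /\ Q *m A = diag_mx D *m Q.
Proof.
move=> sA; elim: k => [_|k IH kd].
  by exists 0, 0; split; apply/matrixP => -[].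
have [Q [D [Q1 QA]]] := IH (ltnW kd).
have [x [mu [x1 xQ xA]]] := orthogonal_eigenvector sA kd QA.
(* The size is written [1 + k] so that the new eigenvector can be stacked on top of [Q] by
   [col_mx]. *)
suff : exists (Q : 'M[R]_(1 + k, d)) D,
    Q *m Q^T = 1%:M /\ Q *m A = diag_mx D *m Q.
  by [].
exists (col_mx x Q), (row_mx (mu%:M : 'rV[R]_1) D); split.
  rewrite tr_col_mx mul_col_row dot_mx x1 xQ Q1.
  by rewrite -[Q *m x^T]trmxK trmx_mul trmxK xQ trmx0 -scalar_mx_block.
rewrite mul_col_mx xA QA diag_mx_row mul_block_col !mul0mx addr0 add0r.
congr col_mx; rewrite -mul_scalar_mx; congr (_ *m _).
by apply/matrixP => i j; rewrite !ord1 !mxE.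
Qed.

Lemma spectral_theorem A : A^T = A ->
  exists (Q : 'M[R]_d) D, Q *m Q^T = 1%:M /\ A = Q^T *m diag_mx D *m Q.
Proof.
move=> sA; have [Q [D [Q1 QA]]] := orthonormal_eigenvectors sA (leqnn d).
exists Q, D; split => //.
by rewrite -mulmxA -QA mulmxA (mulmx1C Q1) mul1mx.
Qed.

End Spectral.

(** * Trace inequalities for powers with exponent [2 ^ p] *)

Section TracePower.
Context {R : realType} {d : nat}.
Implicit Types (A B X : 'M[R]_d).

Lemma trmx_mulr A B : (A * B)^T = B^T * A^T.
Proof. exact: trmx_mul. Qed.

Lemma mxtrace_mulrC A B : \tr (A * B) = \tr (B * A).
Proof. exact: mxtrace_mulC. Qed.

Lemma trmx_exp A n : (A ^+ n)^T = A^T ^+ n.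
Proof.
elim: n => [|n IH]; first by rewrite !expr0 -idmxE trmx1.
by rewrite exprS exprSr trmx_mulr IH.
Qed.

Lemma mxtrace_mulr_exp A B n : \tr ((A * B) ^+ n) = \tr ((B * A) ^+ n).
Proof.
case: n => [|n]; first by rewrite !expr0.
have expE : (A * B) ^+ n * A = A * (B * A) ^+ n.
  elim: n => [|n IH]; first by rewrite !expr0 mul1r mulr1.
  by rewrite exprS -mulrA IH exprS !mulrA.
by rewrite exprSr mulrA expE mxtrace_mulrC mulrA exprS.
Qed.

Lemma mxtrace_mul_tr_ge0 A : 0 <= \tr (A * A^T).
Proof.
apply: sumr_ge0 => i _; rewrite mxE; apply: sumr_ge0 => j _.
by rewrite mxE -expr2 sqr_ge0.
Qed.

Lemma mxtrace_mul_le A B :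
  2 * \tr (A * B^T) <= \tr (A * A^T) + \tr (B * B^T).
Proof.
have := mxtrace_mul_tr_ge0 (A - B); rewrite linearB /= mulrBl !mulrBr.
rewrite !raddfB /= -(mxtrace_tr (B * A^T)) trmx_mulr trmxK.
lra.
Qed.

(* Proved together: each inequality at level [p.+1] uses both at level [p]. *)
Lemma mxtrace_pow2_le p :
  (forall A B, A^T = A -> B^T = B ->
     \tr ((A * B) ^+ (2 ^ p)) <= \tr (A ^+ (2 ^ p) * B ^+ (2 ^ p))) /\
  (forall X, \tr (X ^+ (2 ^ p.+1)) <= \tr ((X * X^T) ^+ (2 ^ p))).
Proof.
elim: p => [|p [IH1 IH2]].
  split=> [A B _ _|X]; first by rewrite !expr1.
  rewrite expn1 expr1 expr2.
  have := mxtrace_mul_le X X^T; rewrite trmxK (mxtrace_mulrC X^T); lra.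
split=> [A B sA sB|X].
  (* With [X = A * B], the product [X * X^T] is [A * B * B * A]; cycling one factor [A] turns it
     into [(A * A) * (B * B)], to which the first inequality applies. *)
  apply: (le_trans (IH2 _)); rewrite trmx_mulr sA sB mulrA.
  rewrite mxtrace_mulr_exp !mulrA -mulrA.
  have sqr_sym (C : 'M[R]_d) : C^T = C -> (C * C)^T = C * C.
    by rewrite trmx_mulr => ->.
  apply: (le_trans (IH1 _ _ (sqr_sym _ sA) (sqr_sym _ sB))).
  by rewrite -!expr2 -!exprM -expnS.
(* The second inequality for [X ^+ 2], followed by cycling, yields the product of the symmetric
   matrices [X * X^T] and [X^T * X]. After the first inequality, [mxtrace_mul_le] separates them,
   and both squares have the same trace. *)
rewrite [(2 ^ p.+2)%N]expnS exprM; apply: (le_trans (IH2 _)).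
rewrite expr2 trmx_mulr -mulrA mxtrace_mulr_exp.
have -> : X * (X^T * X^T) * X = X * X^T * (X^T * X) by rewrite !mulrA.
have sX (Y : 'M[R]_d) : (Y * Y^T)^T = Y * Y^T by rewrite trmx_mulr trmxK.
have := IH1 _ _ (sX X) (sX X^T); rewrite trmxK => /le_trans; apply.
have := mxtrace_mul_le ((X * X^T) ^+ (2 ^ p)) ((X^T * X) ^+ (2 ^ p)).
rewrite !trmx_exp !trmx_mulr !trmxK -!exprD addnn -mul2n -expnS.
rewrite (mxtrace_mulr_exp X^T); lra.
Qed.

End TracePower.

(** * Row-sum norm estimates and the Lie-Trotter error *)

Section RowBound.
Context {R : realType} {d : nat}.
Implicit Types (A B : 'M[R]_d) (a b c e : R).

(** An upper bound on the operator norm induced by the sup norm: submultiplicative, and it controls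
    the trace. *)
Definition row_bound A c := forall i, \sum_j `|A i j| <= c.

Lemma row_bound_ex A : exists2 c, 0 <= c & row_bound A c.
Proof.
exists (\sum_i \sum_j `|A i j|) => [|i].
  by rewrite !sumr_ge0// => i _; rewrite sumr_ge0.
by rewrite [leRHS](bigD1 i)//= lerDl sumr_ge0// => j _; rewrite sumr_ge0.
Qed.

Lemma row_boundW A a b : a <= b -> row_bound A a -> row_bound A b.
Proof. by move=> ab Aa i; exact: le_trans (Aa i) ab. Qed.

Lemma row_bound1 : row_bound 1 1.
Proof.
move=> i; rewrite (bigD1 i)//= big1 ?addr0 => [|j ji]; rewrite -idmxE !mxE.
  by rewrite eqxx normr1.
by rewrite eq_sym (negbTE ji) normr0.
Qed.

Lemma row_boundD A B a b : row_bound A a -> row_bound B b ->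
  row_bound (A + B) (a + b).
Proof.
move=> Aa Bb i; apply: le_trans (lerD (Aa i) (Bb i)); rewrite -big_split/=.
by apply: ler_sum => j _; rewrite mxE ler_normD.
Qed.

Lemma row_boundZ A a c : 0 <= c -> row_bound A a -> row_bound (c *: A) (c * a).
Proof.
move=> c0 Aa i; under eq_bigr do rewrite mxE normrM ger0_norm//.
by rewrite -mulr_sumr ler_wpM2l.
Qed.

Lemma row_boundM A B a b : 0 <= b -> row_bound A a -> row_bound B b ->
  row_bound (A * B) (a * b).
Proof.
move=> b0 Aa Bb i.
apply: (@le_trans _ _ (\sum_k `|A i k| * \sum_j `|B k j|)); last first.
  apply: le_trans (ler_wpM2r b0 (Aa i)); rewrite mulr_suml.
  by apply: ler_sum => k _; rewrite ler_wpM2l.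
under [leRHS]eq_bigr do rewrite mulr_sumr.
rewrite exchange_big/=; apply: ler_sum => j _; rewrite -mulmxE mxE.
apply: le_trans (ler_norm_sum _ _ _) _.
by apply: ler_sum => k _; rewrite normrM.
Qed.

Lemma row_boundX A a n : 0 <= a -> row_bound A a -> row_bound (A ^+ n) (a ^+ n).
Proof.
move=> a0 Aa; elim: n => [|n IH]; first by rewrite !expr0; exact: row_bound1.
by rewrite !exprS; apply: row_boundM => //; rewrite exprn_ge0.
Qed.

(** Telescoping: each of the [n] replacements of a factor [A] by [B] costs [e] times at most
    [c ^+ n], where [1 <= c] absorbs the exponent [n - 1]. *)
Lemma row_boundXB A B c e n : 1 <= c -> 0 <= e ->
  row_bound A c -> row_bound B c -> row_bound (A - B) e ->
  row_bound (A ^+ n - B ^+ n) (n%:R * c ^+ n * e).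
Proof.
move=> c1 e0 Ac Bc ABe; have c0 : 0 <= c by apply: le_trans c1.
elim: n => [|n IH].
  rewrite !expr0 subrr !mul0r => i.
  by rewrite big1// => j _; rewrite mxE normr0.
have -> : A ^+ n.+1 - B ^+ n.+1 = A ^+ n * (A - B) + (A ^+ n - B ^+ n) * B.
  by rewrite mulrBr mulrBl addrA subrK -!exprSr.
apply: row_boundW (row_boundD (row_boundM e0 (row_boundX n c0 Ac) ABe)
                              (row_boundM c0 IH Bc)).
have := mulr_ge0 (mulr_ge0 (exprn_ge0 n c0) e0) (_ : 0 <= c - 1).
rewrite subr_ge0 => /(_ c1); rewrite exprS -natr1; lra.
Qed.

Lemma mxtrace_row_bound A c : row_bound A c -> `|\tr A| <= d%:R * c.
Proof.
move=> Ac; apply: (le_trans (ler_norm_sum _ _ _)).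
apply: (@le_trans _ _ (\sum_(i < d) c)).
  apply: ler_sum => i _; apply: le_trans (Ac i).
  by rewrite (bigD1 i)//= lerDl sumr_ge0.
by rewrite sumr_const card_ord mulr_natl.
Qed.

Lemma le_exp_expR (x : R) n : -1 <= x -> (1 + x) ^+ n <= expR (n%:R * x).
Proof.
move=> x1; rewrite expRM_natl lerXn2r ?nnegrE ?expR_ge0 ?expR_ge1Dx//; lra.
Qed.

(* [1 + u(A + B)] and [(1 + uA)(1 + uB)] differ by [u^2 AB]. *)
Lemma mxtrace_pow2_lie_trotter A B : A^T = A -> B^T = B ->
  exists C, forall p N u, N = (2 ^ p)%N -> u = N%:R^-1 ->
    \tr ((1 + u *: (A + B)) ^+ N) <=
    \tr ((1 + u *: A) ^+ N * (1 + u *: B) ^+ N) + C * 2^-1 ^+ p.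
Proof.
move=> sA sB; have [a a0 Aa] := row_bound_ex A.
have [b b0 Bb] := row_bound_ex B.
(* As [u <= 1], both [1 + u(A + B)] and the product have row sums at most [1 + u * K], and
   [(1 + u * K) ^+ N <= expR K] uniformly in [N]. *)
pose K := a + b + a * b.
have K0 : 0 <= K by rewrite !addr_ge0 ?mulr_ge0.
exists (d%:R * (expR K * (a * b))) => p N u NE uE'.
have N0 : 0 < N%:R :> R by rewrite NE ltr0n expn_gt0.
have u0 : 0 < u by rewrite uE' invr_gt0.
have u1 : u <= 1 by rewrite uE' invf_le1// NE ler1n expn_gt0.
have uE : u = 2^-1 ^+ p by rewrite uE' NE natrX exprVn.
have uK c : 0 <= c -> u ^+ 2 * c <= u * c.
  by move=> c0; rewrite ler_wpM2r// expr2 ger_pMl.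
have K1 : 1 <= 1 + u * K by rewrite lerDl mulr_ge0// ltW.
have row1D c M : row_bound M c -> row_bound (1 + u *: M) (1 + u * c).
  move=> Mc; apply: row_boundD; first exact: row_bound1.
  by apply: row_boundZ => //; exact: ltW.
pose M1 := 1 + u *: (A + B); pose M2 := (1 + u *: A) * (1 + u *: B).
have M1K : row_bound M1 (1 + u * K).
  apply: row_boundW (row1D _ _ (row_boundD Aa Bb)).
  by rewrite lerD2l ler_wpM2l ?(ltW u0)// lerDl mulr_ge0.
have M2K : row_bound M2 (1 + u * K).
  apply: row_boundW (row_boundM _ (row1D _ _ Aa) (row1D _ _ Bb)).
    have := uK _ (mulr_ge0 a0 b0); rewrite /K; lra.
  by rewrite addr_ge0// mulr_ge0// ltW.
have M12 : row_bound (M1 - M2) (u ^+ 2 * (a * b)).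
  have -> : M1 - M2 = - (u ^+ 2 *: (A * B)).
    rewrite /M1 /M2 mulrDl mul1r mulrDr mulr1 -!mulmxE -scalemxAl.
    rewrite -scalemxAr scalerA -expr2.
    by rewrite scalerDr; apply/matrixP => i j; rewrite !mxE; ring.
  move=> i; under eq_bigr do rewrite mxE normrN.
  by apply: row_boundZ; [exact: exprn_ge0 (ltW u0)|exact: row_boundM].
have sD (X : 'M[R]_d) : X^T = X -> (1 + u *: X)^T = 1 + u *: X.
  by move=> sX; rewrite linearD linearZ /= sX -idmxE trmx1.
have [/(_ _ _ (sD _ sA) (sD _ sB)) GT _] := @mxtrace_pow2_le R d p.
rewrite -NE in GT; apply: le_trans (lerD GT (lexx _)).
rewrite -lerBlDl -raddfB /=.
apply: (le_trans (ler_norm _)).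
have e0 : 0 <= u ^+ 2 * (a * b) by rewrite !mulr_ge0// ?exprn_ge0// ltW.
apply: (le_trans (mxtrace_row_bound (row_boundXB N K1 e0 M1K M2K M12))).
rewrite -[leRHS]mulrA ler_wpM2l//.
(* The factor [N] from telescoping cancels one of the two factors [u]; the other is the rate
   [2^-1 ^+ p]. *)
rewrite [leLHS](_ : _ = (1 + u * K) ^+ N * (a * b) * u).
  rewrite -uE ler_wpM2r ?(ltW u0)// ler_wpM2r ?mulr_ge0//.
  apply: (le_trans (le_exp_expR _ _)).
    by rewrite (le_trans _ (mulr_ge0 (ltW u0) K0)).
  by rewrite uE' mulrA divff ?mul1r// gt_eqF.
by rewrite uE'; field; rewrite gt_eqF.
Qed.

End RowBound.

(** * Functional calculus for symmetric matrices *)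

Section SpectralCalculus.
Local Open Scope classical_set_scope.
Context {R : realType} {d : nat}.
Implicit Types (A B : 'M[R]_d) (x : 'rV[R]_d) (f g : R -> R).

(** One diagonalization is chosen once and for all, so that eigenvectors, eigenvalues and [mxfun]
    share a basis. For symmetric [A] the default [(0, 0)] is not reached. *)
Definition spectral_decomposition A : 'M[R]_d * 'rV[R]_d :=
  xget (0, 0) [set QD | QD.1 *m QD.1^T = 1%:M /\
                        A = QD.1^T *m diag_mx QD.2 *m QD.1].

Definition eigvec A i : 'rV[R]_d := row i (spectral_decomposition A).1.
Definition eigval A i : R := (spectral_decomposition A).2 0 i.

Definition mxfun f A : 'M[R]_d :=
  let: (Q, D) := spectral_decomposition A in
  Q^T *m diag_mx (map_mx f D) *m Q.

Lemma spectral_decompositionP A : A^T = A ->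
  let: (Q, D) := spectral_decomposition A in
  Q *m Q^T = 1%:M /\ A = Q^T *m diag_mx D *m Q.
Proof.
move=> /spectral_theorem[Q [D QD]]; rewrite /spectral_decomposition.
set P := (P in xget _ P); have PQD : P (Q, D) by [].
have := xgetI (0, 0) PQD; rewrite /P /=.
by case: xget.
Qed.

Lemma dot_eigvec A i j : A^T = A -> dot (eigvec A i) (eigvec A j) = (i == j)%:R.
Proof.
move=> /spectral_decompositionP; rewrite /eigvec.
case: spectral_decomposition => Q D [/matrixP /(_ i j) + _].
rewrite !mxE => <-; rewrite dotE.
by apply: eq_bigr => k _; rewrite !mxE.
Qed.

Lemma mxfunE f A : mxfun f A =
  \sum_i f (eigval A i) *: ((eigvec A i)^T *m eigvec A i).
Proof.
rewrite /mxfun /eigval /eigvec; case: spectral_decomposition => Q D.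
apply/matrixP => k l; rewrite mxE summxE; apply: eq_bigr => i _.
by rewrite mul_mx_diag !mxE big_ord1 !mxE mulrAC mulrC.
Qed.

Lemma dot_mxfun f A x :
  dot (x *m mxfun f A) x = \sum_i f (eigval A i) * dot x (eigvec A i) ^+ 2.
Proof.
rewrite mxfunE mulmx_sumr dot_suml; apply: eq_bigr => i _.
by rewrite -scalemxAr dotZl mulmxA dot_mx mul_scalar_mx dotZl (dotC _ x) -expr2.
Qed.

Lemma mxtrace_mxfun_mul f A B : \tr (mxfun f A *m B) =
  \sum_i f (eigval A i) * dot (eigvec A i *m B) (eigvec A i).
Proof.
rewrite mxfunE mulmx_suml linear_sum/=; apply: eq_bigr => i _.
rewrite -scalemxAl linearZ/=; congr (_ * _).
by rewrite -mulmxA mxtrace_mulC dot_mx mxtrace_scalar.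
Qed.

Lemma mxfun_id A : A^T = A -> mxfun id A = A.
Proof.
move=> /spectral_decompositionP; rewrite /mxfun.
by case: spectral_decomposition => Q D [_ ->]; rewrite map_mx_id.
Qed.

Lemma mxfun_cst1 A : A^T = A -> mxfun (fun=> 1) A = 1.
Proof.
move=> /spectral_decompositionP; rewrite /mxfun.
case: spectral_decomposition => Q D [Q1 _].
have -> : map_mx (fun=> 1 : R) D = const_mx 1 by apply/rowP => i; rewrite !mxE.
by rewrite diag_const_mx mulmx1 (mulmx1C Q1).
Qed.

Lemma mxfunM f g A : A^T = A -> mxfun f A * mxfun g A = mxfun (f \* g) A.
Proof.
move=> /spectral_decompositionP; rewrite /mxfun -mulmxE.
case: spectral_decomposition => Q D [Q1 _].
rewrite -!mulmxA (mulmxA Q) Q1 mul1mx (mulmxA (diag_mx _)) mulmx_diag.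
by congr (_ *m (diag_mx _ *m _)); apply/rowP => i; rewrite !mxE.
Qed.

Lemma mxfunD f g A : mxfun f A + mxfun g A = mxfun (f \+ g) A.
Proof.
by rewrite !mxfunE -big_split; apply: eq_bigr => i _; rewrite scalerDl.
Qed.

Lemma mxfunZ c f A : c *: mxfun f A = mxfun (fun t => c * f t) A.
Proof.
by rewrite !mxfunE scaler_sumr; apply: eq_bigr => i _; rewrite scalerA.
Qed.

Lemma mxfunX f A n : A^T = A -> mxfun f A ^+ n = mxfun (fun t => f t ^+ n) A.
Proof.
move=> sA; elim: n => [|n IH]; first by rewrite expr0 -[LHS](mxfun_cst1 sA).
rewrite exprS IH mxfunM//; congr (mxfun _ A).
by apply/funext => t; rewrite /= exprS.
Qed.

(** Brings ring powers into the functional calculus, so that the limit giving the exponential can be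
    taken eigenvalue by eigenvalue. *)
Lemma mxfun_pow u A n : A^T = A ->
  (1 + u *: A) ^+ n = mxfun (fun t => (1 + u * t) ^+ n) A.
Proof.
move=> sA; rewrite -[A in LHS]mxfun_id// -(mxfun_cst1 sA).
by rewrite mxfunZ mxfunD mxfunX.
Qed.

Lemma sum_dot_eigvec A x : A^T = A ->
  \sum_i dot x (eigvec A i) ^+ 2 = dot x x.
Proof.
move=> sA; have := dot_mxfun (fun=> 1) A x; rewrite mxfun_cst1// mulmx1 => ->.
by apply: eq_bigr => i _; rewrite mul1r.
Qed.

Lemma eigvec_mul A i : A^T = A -> eigvec A i *m A = eigval A i *: eigvec A i.
Proof.
move=> sA; rewrite -[A in _ *m A]mxfun_id// mxfunE mulmx_sumr (bigD1 i)//=.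
rewrite -scalemxAr mulmxA dot_mx dot_eigvec// eqxx mul1mx big1 ?addr0// => j ji.
rewrite -scalemxAr mulmxA dot_mx dot_eigvec// eq_sym (negbTE ji).
by rewrite mul_scalar_mx scale0r scaler0.
Qed.

Lemma mxtrace_mxfun f A : A^T = A -> \tr (mxfun f A) = \sum_i f (eigval A i).
Proof.
move=> sA; have := mxtrace_mxfun_mul f A 1%:M; rewrite mulmx1 => ->.
by apply: eq_bigr => i _; rewrite mulmx1 dot_eigvec// eqxx mulr1.
Qed.

End SpectralCalculus.

(** * The Golden-Thompson inequality *)

Section GoldenThompson.
Local Open Scope classical_set_scope.
Context {R : realType}.

Lemma bernoulli_inequality (t : R) n : 0 <= t <= 1 ->
  1 - n%:R * t <= (1 - t) ^+ n.
Proof.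
case/andP=> t0 t1; elim: n => [|n IH]; first by rewrite mul0r subr0 expr0.
have := ler_wpM2l (_ : 0 <= 1 - t) IH; rewrite subr_ge0 => /(_ t1).
have := mulr_ge0 (ler0n R n) (sqr_ge0 t).
rewrite [(1 - t) ^+ _.+1]exprS -natr1; lra.
Qed.

Lemma cvg_half_exp (C : R) : C * 2^-1 ^+ p @[p --> \oo] --> 0.
Proof.
rewrite -[X in _ --> X](mulr0 C); apply: cvgM; first exact: cvg_cst.
by apply: cvg_expr; rewrite ger0_norm ?invr_ge0// invf_lt1// ltr1n.
Qed.

(** With [y = x / N], the power is at most [expR x]. Below, [expR x * (1 - y) ^+ N <= 1] gives [expR
    x * (1 - y ^+ 2) ^+ N <= (1 + y) ^+ N], and Bernoulli bounds the left side. Both need [y] in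
    [[-1, 1]], which holds eventually. *)
Lemma cvg_pow2_expR (x : R) :
  (1 + (2 ^ p)%N%:R^-1 * x) ^+ (2 ^ p) @[p --> \oo] --> expR x.
Proof.
apply: (@squeeze_cvgr _ _ _ _ (fun p => expR x * (1 - x ^+ 2 * 2^-1 ^+ p))
   (fun=> expR x)); last exact: cvg_cst; last first.
  rewrite -[X in _ --> X]mulr1; apply: cvgM; first exact: cvg_cst.
  rewrite -[X in _ --> X]subr0; apply: cvgB; first exact: cvg_cst.
  exact: cvg_half_exp.
have /cvgr0_norm_le/(_ 1 ltr01) := cvg_half_exp x.
apply: filterS => p; set N := (2 ^ p)%N; set y := N%:R^-1 * x.
have N0 : 0 < N%:R :> R by rewrite ltr0n expn_gt0.
have uE : 2^-1 ^+ p = N%:R^-1 :> R by rewrite natrX exprVn.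
rewrite uE mulrC -/y ler_norml => /andP[y1 y2].
have NyE : N%:R * y = x by rewrite /y mulrA divff ?mul1r// gt_eqF.
have y21 : 0 <= y ^+ 2 <= 1 by rewrite sqr_ge0 -[leRHS](expr1n _ 2); nra.
apply/andP; split; last by rewrite (le_trans (le_exp_expR _ y1))// NyE.
apply: (@le_trans _ _ (expR x * (1 - y ^+ 2) ^+ N)).
  rewrite ler_wpM2l ?expR_ge0//; apply: le_trans (bernoulli_inequality N y21).
  by rewrite [leRHS](_ : _ = 1 - x ^+ 2 * N%:R^-1)// /y; field; rewrite gt_eqF.
have -> : 1 - y ^+ 2 = (1 - y) * (1 + y) by ring.
rewrite exprMn mulrA -[leRHS]mul1r ler_wpM2r ?exprn_ge0//; first by lra.
rewrite -[x in expR x]NyE expRM_natl -exprMn exprn_ile1//.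
  by rewrite mulr_ge0 ?expR_ge0//; lra.
by rewrite -[leRHS](expRxMexpNx_1 y) ler_wpM2l ?expR_ge0// expR_ge1Dx.
Qed.

(** Limit of [mxtrace_pow2_lie_trotter]: written over eigenvalues, both traces are finite sums of
    scalar limits, and the error vanishes. *)
Lemma golden_thompson d (A B : 'M[R]_d) : A^T = A -> B^T = B ->
  \tr (mxfun expR (A + B)) <= \tr (mxfun expR A *m mxfun expR B).
Proof.
move=> sA sB; have [C le_p] := mxtrace_pow2_lie_trotter sA sB.
have sAB : (A + B)^T = A + B by rewrite linearD /= sA sB.
pose e p (t : R) := (1 + (2 ^ p)%N%:R^-1 * t) ^+ (2 ^ p).
have cvg_e t : e p t @[p --> \oo] --> expR t by exact: cvg_pow2_expR.
have add_cont : continuous (fun x : R * R => x.1 + x.2).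
  exact: add_continuous.
have cvg_tr1 : \tr (mxfun (e p) (A + B)) @[p --> \oo] -->
    \tr (mxfun expR (A + B)).
  rewrite mxtrace_mxfun//; under eq_cvg do rewrite mxtrace_mxfun//.
  refine (@cvg_big _ _ _ 0 xpredT add_cont _ _ _ _ _ _ _) => i _.
  exact: cvg_e.
have cvg_tr2 : \tr (mxfun (e p) A *m mxfun (e p) B) @[p --> \oo] -->
    \tr (mxfun expR A *m mxfun expR B).
  rewrite mxtrace_mxfun_mul; under eq_cvg do rewrite mxtrace_mxfun_mul.
  refine (@cvg_big _ _ _ 0 xpredT add_cont _ _ _ _ _ _ _) => i _.
  apply: cvgM; first exact: cvg_e.
  rewrite dot_mxfun; under eq_cvg do rewrite dot_mxfun.
  refine (@cvg_big _ _ _ 0 xpredT add_cont _ _ _ _ _ _ _) => j _.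
  by apply: cvgM; [exact: cvg_e|exact: cvg_cst].
have := cvgD cvg_tr2 (cvg_half_exp C); rewrite addr0 => /(_ _) cvg_tr2'.
refine (ler_cvg_to cvg_tr1 cvg_tr2' _); near=> p.
by have := le_p p _ _ erefl erefl; rewrite !mxfun_pow.
Unshelve. all: by end_near. Qed.

End GoldenThompson.

(** * The trace exponential as a potential *)

Section TraceExp.
Context {R : realType} {d : nat}.
Implicit Types (A B D H Y : 'M[R]_d) (x : 'rV[R]_d).

Definition trexp A : R := \tr (mxfun expR A).

(* Jensen's inequality for the weights [dot x (eigvec A i) ^+ 2]. *)
Lemma expR_dot_le A x : A^T = A -> dot x x = 1 ->
  expR (dot (x *m A) x) <= dot (x *m mxfun expR A) x.
Proof.
move=> sA x1; set m := dot _ _; rewrite dot_mxfun.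
have mE : m = \sum_i eigval A i * dot x (eigvec A i) ^+ 2.
  by rewrite /m -[A in _ *m A]mxfun_id// dot_mxfun.
apply: (@le_trans _ _ (\sum_i expR m * (1 + (eigval A i - m)) *
    dot x (eigvec A i) ^+ 2)); last first.
  apply: ler_sum => i _; rewrite ler_wpM2r ?sqr_ge0//.
  have -> : expR (eigval A i) = expR m * expR (eigval A i - m).
    by rewrite -expRD addrC subrK.
  by rewrite ler_wpM2l ?expR_ge0// expR_ge1Dx.
under eq_bigr => i _ do rewrite -mulrA addrCA mulrDl.
rewrite -mulr_sumr big_split/= -mE -mulr_sumr sum_dot_eigvec// x1.
by rewrite mulr1 addrC subrK mulr1.
Qed.

(** After Jensen, each weight [dot x (eigvec A i) ^+ 2] is at most 1, as the weights sum to 1. *)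
Lemma expR_dot_le_trexp A x : A^T = A -> dot x x = 1 ->
  expR (dot (x *m A) x) <= trexp A.
Proof.
move=> sA x1; apply: (le_trans (expR_dot_le sA x1)).
rewrite dot_mxfun /trexp mxtrace_mxfun//; apply: ler_sum => i _.
rewrite ger_pMr ?expR_gt0// -x1 -(sum_dot_eigvec x sA) (bigD1 i)//=.
by rewrite lerDl sumr_ge0// => j _; rewrite sqr_ge0.
Qed.

Lemma sum_eigvec_mxfun f A B : A^T = A ->
  \sum_i dot (eigvec A i *m mxfun f B) (eigvec A i) = \tr (mxfun f B).
Proof.
move=> sA; have := mxtrace_mxfun_mul (fun=> 1) A (mxfun f B).
rewrite mxfun_cst1// mul1mx => ->.
by apply: eq_bigr => i _; rewrite mul1r.
Qed.

(* Peierls' inequality: both sides are compared in the eigenbasis of [H]. *)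
Lemma trexp_midpoint_convex H D : H^T = H -> D^T = D ->
  2 * trexp H <= trexp (H + D) + trexp (H - D).
Proof.
move=> sH sD.
have sHD : (H + D)^T = H + D by rewrite linearD /= sH sD.
have sHB : (H - D)^T = H - D by rewrite linearB /= sH sD.
rewrite /trexp -(sum_eigvec_mxfun expR (H + D) sH).
rewrite -(sum_eigvec_mxfun expR (H - D) sH) -big_split/= mxtrace_mxfun//.
rewrite mulr_sumr; apply: ler_sum => i _; set q := eigvec H i.
have q1 : dot q q = 1 by rewrite dot_eigvec// eqxx.
apply: le_trans (lerD (expR_dot_le sHD q1) (expR_dot_le sHB q1)).
rewrite mulmxBr mulmxDr -scaleN1r !dotDl dotZl eigvec_mul// dotZl.
rewrite q1 mulr1 mulN1r.
move: (eigval H i) (dot (q *m D) q) => h t.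
rewrite !expRD -mulrDr mulrC ler_wpM2l ?expR_ge0//.
have := expR_ge1Dx t; have := expR_ge1Dx (- t); lra.
Qed.

Lemma trexp0 : trexp 0 = d%:R.
Proof.
have s0 : (0 : 'M[R]_d)^T = 0 by rewrite trmx0.
rewrite /trexp mxtrace_mxfun// (eq_bigr (fun=> 1)).
  by rewrite sumr_const card_ord.
(* The decomposition of [0] is only a choice, so its eigenvalues are found to vanish through the
   eigenvector equation. *)
move=> i _; have /(congr1 (fun v => dot v (eigvec 0 i))) := eigvec_mul i s0.
by rewrite mulmx0 dot0l dotZl dot_eigvec// eqxx mulr1 => <-; rewrite expR0.
Qed.

(** Dividing by [expR y] leaves [1 <= expR (- y) * q] with [q] the quadratic. For [y <= 0] use
    [expR (- y) >= 1 - y]; for [y > 0] the sharper [expR (- y) >= (1 - y / 4) ^+ 4]. *)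
Lemma expR_le_quadratic (y : R) : y <= 3 / 4 ->
  expR y <= 1 + y + 4 / 3 * y ^+ 2.
Proof.
move=> y34; rewrite -[leRHS]mul1r -[X in X * _](expRxMexpNx_1 y) -mulrA.
have q0 : 0 <= 1 + y + 4 / 3 * y ^+ 2.
  rewrite (_ : _ + _ = 4 / 3 * (y + 3 / 8) ^+ 2 + 13 / 16); last by field.
  by rewrite addr_ge0// mulr_ge0 ?sqr_ge0.
rewrite ler_pMr ?expR_gt0//; have [y0|y0] := leP y 0.
  apply: le_trans (ler_wpM2r q0 (expR_ge1Dx (- y))).
  rewrite -subr_ge0 (_ : _ - 1 = y ^+ 2 * (1 / 3 - 4 / 3 * y)); last by field.
  by apply: mulr_ge0; [exact: sqr_ge0|lra].
have -> : expR (- y) = expR (- y / 4) ^+ 4.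
  by rewrite -expRM_natl; congr expR; field.
apply: (@le_trans _ _ ((1 - y / 4) ^+ 4 * (1 + y + 4 / 3 * y ^+ 2))); last first.
  rewrite ler_wpM2r//.
  have := expR_ge1Dx (- y / 4); rewrite mulNr => ?.
  by rewrite lerXn2r ?nnegrE ?expR_ge0//; lra.
rewrite -subr_ge0 (_ : _ - 1 = y ^+ 2 * (17 / 24 - 49 / 48 * y +
  113 / 256 * y ^+ 2 - 61 / 768 * y ^+ 3 + y ^+ 4 / 192)); last by field.
apply: mulr_ge0; first exact: sqr_ge0.
have y2 : 0 <= y ^+ 2 by exact: sqr_ge0.
have y3 : y ^+ 3 <= 3 / 4 * y ^+ 2 by rewrite exprS ler_wpM2r.
have y4 : 0 <= y ^+ 4 by rewrite exprn_ge0// ltW.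
(* The cubic term is absorbed by the quadratic one; the tangent of [y ^+ 2] at [4 / 3], close to the
   vertex of the result, reduces the claim to a linear one. *)
have := sqr_ge0 (y - 4 / 3); rewrite sqrrB; lra.
Qed.

(** The bound on the quadratic form puts every eigenvalue below [3 / 4], so the scalar inequality
    applies in the eigenbasis. *)
Lemma dot_mxfun_expR_le Y x : Y^T = Y ->
  (forall z, dot (z *m Y) z <= 3 / 4 * dot z z) ->
  dot (x *m mxfun expR Y) x <=
  dot x x + dot (x *m Y) x + 4 / 3 * dot (x *m Y) (x *m Y).
Proof.
move=> sY Y1.
have -> : dot (x *m Y) (x *m Y) = dot (x *m mxfun (fun t => t * t) Y) x.
  rewrite -[mxfun _ _](mxfunM id id sY) mxfun_id// -mulmxE mulmxA.
  by rewrite [RHS]dot_mull sY.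
rewrite -[Y in _ + dot (_ *m Y) _ + _]mxfun_id// !dot_mxfun.
rewrite -(sum_dot_eigvec x sY) mulr_sumr -!big_split/=; apply: ler_sum => i _.
have e34 : eigval Y i <= 3 / 4.
  have := Y1 (eigvec Y i).
  by rewrite eigvec_mul// dotZl dot_eigvec// eqxx !mulr1.
apply: le_trans (ler_wpM2r (sqr_ge0 _) (expR_le_quadratic e34)) _.
by rewrite le_eqVlt; apply/orP; left; apply/eqP => /=; ring.
Qed.

End TraceExp.

(** * Midpoint-convex functions of sums sampled without replacement *)

Section SamplingWithoutReplacement.
Context {R : realType} {I : finType} {V : zmodType}.
Variables (T : {set I}) (Y : I -> V) (f : V -> R) (c : R).

Let sumY (S : {set I}) := \sum_(j in S) Y j.

Definition subset_sum k :=
  \sum_(S : {set I} | (S \subset T) && (#|S| == k)) f (\sum_(j in S) Y j).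

(** Double counting: a [k]-subset with a new element [u] is the same as a [k.+1]-subset with a
    marked element [u]. *)
Lemma reindex_subset_add k (g : {set I} -> I -> R) :
  \sum_(S : {set I} | (S \subset T) && (#|S| == k)) \sum_(u in T :\: S) g S u =
  \sum_(S : {set I} | (S \subset T) && (#|S| == k.+1))
    \sum_(u in S) g (S :\ u) u.
Proof.
rewrite !pair_big_dep/=.
rewrite (reindex_onto (fun p : {set I} * I => (p.1 :\ p.2, p.2))
   (fun p => (p.2 |: p.1, p.2))) /=; last first.
  move=> [S u] /= /andP[_]; rewrite inE => /andP[uS _].
  by rewrite finset.setU1K.
apply: eq_bigl => -[S u] /=; apply/idP/idP.
  case/andP=> /andP[/andP[ST /eqP Sk] +] /eqP[SE]; rewrite !inE eqxx/= => uT.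
  have uS : u \in S by rewrite -SE finset.setU11.
  rewrite uS (cardsD1 u S) uS Sk eqxx !andbT.
  by rewrite -(finset.setD1K uS) finset.subUset finset.sub1set uT.
case/andP=> /andP[ST Sk] uS; rewrite !inE eqxx/= (fintype.subsetP ST)//.
rewrite (finset.setD1K uS) eqxx !andbT.
rewrite (fintype.subset_trans (finset.subsetDl _ _) ST)/=.
by move: Sk; rewrite (cardsD1 u S) uS.
Qed.

Hypothesis f_convex : forall S u z,
  2 * f (sumY S) <= f (sumY S + (Y z - Y u)) + f (sumY S - (Y z - Y u)).
Hypothesis f_step : forall S, \sum_(z in T) f (sumY S + Y z) <= c * f (sumY S).

(* Replacing one element of [S] by another one moves its sum by [Y z - Y u] or
   by the opposite, so that midpoint convexity applies. *)
Lemma sum_swap_ge (S : {set I}) k : #|S| = k.+1 ->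
  (k.+1 * k)%N%:R * f (sumY S) <=
  \sum_(u in S) \sum_(z in S :\ u) f (sumY (S :\ u) + Y z).
Proof.
move=> Sk.
pose F u z := f (sumY S + (Y z - Y u)).
have -> : \sum_(u in S) \sum_(z in S :\ u) f (sumY (S :\ u) + Y z) =
    \sum_(u in S) \sum_(z in S :\ u) F u z.
  apply: eq_bigr => u uS; apply: eq_bigr => z _; congr f.
  rewrite {2}/sumY (big_setD1 u uS)/= -/(sumY _).
  by rewrite [Y u + _]addrC addrACA addrA addrK.
have swap : \sum_(u in S) \sum_(z in S :\ u) F u z =
    \sum_(u in S) \sum_(z in S :\ u) F z u.
  rewrite (exchange_big_dep (mem S))/=; last first.
    by move=> u z _; rewrite !inE => /andP[].
  apply: eq_bigr => z zS; apply: eq_bigl => u.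
  by rewrite !inE zS andbT eq_sym andbC.
(* Adding the double sum to itself with [u] and [z] exchanged pairs opposite displacements, for each
   of the [k.+1 * k] ordered pairs. *)
rewrite -(@ler_pM2l _ 2)// [leRHS]mulr_natl [leRHS]mulr2n {2}swap -big_split/=.
under [leRHS]eq_bigr do rewrite -big_split/=.
apply: (@le_trans _ _ (\sum_(u in S) \sum_(z in S :\ u) 2 * f (sumY S))).
  under eq_bigr => u uS.
    rewrite sumr_const.
    have -> : #|S :\ u| = k by have := cardsD1 u S; rewrite uS Sk => -[].
    over.
  by rewrite sumr_const Sk -mulrnA -[leRHS]mulr_natl [leLHS]mulrCA mulnC.
apply: ler_sum => u _; apply: ler_sum => z _; rewrite /F.
by rewrite -(opprB (Y z) (Y u)); exact: f_convex.
Qed.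

(** Sum [f_step] over all [k]-subsets. Draws outside [S] produce each [k.+1]-subset [k.+1] times;
    repeated draws, weighted by the [#|T| - k] choices of a new [u], become the swapped sums of
    [sum_swap_ge]. The coefficients add up to [k.+1 * #|T|]. *)
Lemma subset_sum_step k : (k < #|T|)%N ->
  (k.+1 * #|T|)%N%:R * subset_sum k.+1 <= (#|T| - k)%N%:R * c * subset_sum k.
Proof.
move=> km; rewrite -mulrA [c * _]mulr_sumr.
apply: (@le_trans _ _ ((#|T| - k)%N%:R *
    \sum_(S : {set I} | (S \subset T) && (#|S| == k))
      \sum_(z in T) f (sumY S + Y z))); last first.
  by rewrite ler_wpM2l// ler_sum// => S _; exact: f_step.
have -> : \sum_(S : {set I} | (S \subset T) && (#|S| == k))
      \sum_(z in T) f (sumY S + Y z) =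
    \sum_(S : {set I} | (S \subset T) && (#|S| == k))
      (\sum_(z in T :\: S) f (sumY S + Y z) + \sum_(z in S) f (sumY S + Y z)).
  apply: eq_bigr => S /andP[ST _]; rewrite (big_setID S)/= addrC.
  by rewrite (finset.setIidPr ST).
rewrite big_split/= mulrDr reindex_subset_add.
have -> : \sum_(S : {set I} | (S \subset T) && (#|S| == k.+1))
    \sum_(u in S) f (sumY (S :\ u) + Y u) = k.+1%:R * subset_sum k.+1.
  rewrite mulr_sumr; apply: eq_bigr => S /andP[_ /eqP Sk].
  rewrite (eq_bigr (fun=> f (sumY S))); first by rewrite sumr_const Sk mulr_natl.
  by move=> u uS; rewrite [in RHS]/sumY (big_setD1 u uS)/= addrC.
have -> : (#|T| - k)%N%:R * \sum_(S : {set I} | (S \subset T) && (#|S| == k))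
      \sum_(z in S) f (sumY S + Y z) =
    \sum_(S : {set I} | (S \subset T) && (#|S| == k.+1))
      \sum_(u in S) \sum_(z in S :\ u) f (sumY (S :\ u) + Y z).
  rewrite -(reindex_subset_add k (fun S u => \sum_(z in S) f (sumY S + Y z))).
  rewrite mulr_sumr; apply: eq_bigr => S /andP[ST /eqP Sk].
  by rewrite sumr_const cardsD (finset.setIidPr ST) Sk mulr_natl.
have -> : (k.+1 * #|T|)%N%:R * subset_sum k.+1 =
   (#|T| - k)%N%:R * (k.+1%:R * subset_sum k.+1) +
   (k.+1 * k)%N%:R * subset_sum k.+1.
  rewrite mulrA -mulrDl -natrM -natrD; congr (_%:R * _).
  by rewrite [(k.+1 * k)%N]mulnC -mulnDl (subnK (ltnW km)) mulnC.
rewrite lerD2l mulr_sumr; apply: ler_sum => S /andP[_ /eqP Sk].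
exact: sum_swap_ge.
Qed.

(** Iterates the step from the empty set: the mean over [k]-subsets is at most
    [(c / #|T|) ^+ k * f 0], stated without division. *)
Lemma subset_sum_le k : 0 <= c -> (k <= #|T|)%N ->
  #|T|%:R ^+ k * subset_sum k <= 'C(#|T|, k)%:R * c ^+ k * f 0.
Proof.
move=> c0; elim: k => [_|k IH km].
  rewrite bin0 !expr0 !mul1r /subset_sum (big_pred1 finset.set0).
    by rewrite big_set0.
  by move=> S; rewrite cards_eq0 andb_idl// => /eqP->; rewrite finset.sub0set.
rewrite -(@ler_pM2l _ k.+1%:R)//.
have m0 : 0 <= #|T|%:R ^+ k :> R by rewrite exprn_ge0.
have := ler_wpM2l m0 (subset_sum_step km).
have mc0 : 0 <= (#|T| - k)%N%:R * c :> R by rewrite mulr_ge0.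
have /(_ (ltnW km))/(ler_wpM2l mc0) := IH.
have := congr1 (fun i => i%:R : R) (mul_bin_left #|T| k); rewrite !natrM.
move=> binE le1 le2.
rewrite [leRHS](_ : _ = (k.+1%:R * 'C(#|T|, k.+1)%:R) * (c ^+ k.+1 * f 0));
  last by ring.
rewrite binE; apply: le_trans (le_trans le2 _).
  by rewrite exprS le_eqVlt; apply/orP; left; apply/eqP; ring.
apply: le_trans (le_trans _ le1) _; rewrite le_eqVlt; apply/orP; left; apply/eqP.
  by ring.
by rewrite exprS; ring.
Qed.

End SamplingWithoutReplacement.

(** * The largest eigenvalue and Rayleigh quotients *)

Section LambdaMax.
Local Open Scope classical_set_scope.
Context {R : realType} {d : nat}.
Implicit Types (A : 'M[R]_d) (x : 'rV[R]_d).

(** Each [eigval A i] lies below the supremum once the set of eigenvalues is known to be bounded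
    above; the sum of the absolute values serves as a bound. *)
Lemma dot_le_lambda_max A x : A^T = A ->
  dot (x *m A) x <= lambda_max A * dot x x.
Proof.
move=> sA.
have eigA i : eigenvalue A (eigval A i).
  apply/eigenvalueP; exists (eigvec A i); first exact: eigvec_mul.
  by rewrite -dot_eq0 dot_eigvec// eqxx oner_neq0.
have quadA y : dot (y *m A) y = \sum_i eigval A i * dot y (eigvec A i) ^+ 2.
  by rewrite -[A in _ *m A]mxfun_id// dot_mxfun.
have ubA : has_ubound [set t | eigenvalue A t].
  exists (\sum_i `|eigval A i|) => t /= /eigenvalueP[v vA v0].
  rewrite -(ler_pM2r (dot_gt0 v0)) -dotZl -vA quadA mulr_suml.
  apply: ler_sum => i _.
  apply: (@le_trans _ _ (`|eigval A i| * dot v (eigvec A i) ^+ 2)).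
    by rewrite ler_wpM2r ?sqr_ge0// ler_norm.
  rewrite ler_wpM2l// -(sum_dot_eigvec v sA) (bigD1 i)//= lerDl.
  by rewrite sumr_ge0// => j _; rewrite sqr_ge0.
rewrite quadA -(sum_dot_eigvec x sA) mulr_sumr; apply: ler_sum => i _.
by rewrite ler_wpM2r ?sqr_ge0//; apply: ub_le_sup => //; exact: eigA.
Qed.

Lemma lambda_max_le A c : (0 < d)%N -> A^T = A ->
  (forall x, dot x x = 1 -> dot (x *m A) x <= c) -> lambda_max A <= c.
Proof.
move=> d0 sA Ac; apply: ge_sup => [|t /= /eigenvalueP[v vA v0]].
  exists (eigval A (Ordinal d0)); apply/eigenvalueP; exists (eigvec A (Ordinal d0)).
    exact: eigvec_mul.
  by rewrite -dot_eq0 dot_eigvec// eqxx oner_neq0.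
have := Ac _ (dot_normalize v0); have := dot_normalize v0.
by rewrite -scalemxAl vA scalerA mulrC -scalerA dotZl => ->; rewrite mulr1.
Qed.

End LambdaMax.

(** * Rank-one matrices and the Cauchy-Schwarz inequality *)

Section RankOne.
Context {R : realType} {d : nat}.
Implicit Types (x v : 'rV[R]_d).

Definition rank1 v : 'M[R]_d := v^T *m v.

Lemma trmx_rank1 v : (rank1 v)^T = rank1 v.
Proof. by rewrite /rank1 trmx_mul trmxK. Qed.

Lemma mul_rank1 x v : x *m rank1 v = dot x v *: v.
Proof. by rewrite /rank1 mulmxA dot_mx mul_scalar_mx. Qed.

Lemma dot_rank1 x v : dot (x *m rank1 v) x = dot x v ^+ 2.
Proof. by rewrite mul_rank1 dotZl (dotC v) -expr2. Qed.

Lemma trmx_sum_rank1 (I : Type) (s : seq I) (P : pred I) (v : I -> 'rV[R]_d) :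
  (\sum_(j <- s | P j) rank1 (v j))^T = \sum_(j <- s | P j) rank1 (v j).
Proof. by rewrite linear_sum/=; apply: eq_bigr => j _; rewrite trmx_rank1. Qed.

Lemma dot_sum_rank1 (I : Type) (s : seq I) (P : pred I) (v : I -> 'rV[R]_d) x :
  dot (x *m (\sum_(j <- s | P j) rank1 (v j))) x =
  \sum_(j <- s | P j) dot x (v j) ^+ 2.
Proof.
by rewrite mulmx_sumr dot_suml; apply: eq_bigr => j _; rewrite dot_rank1.
Qed.

Lemma cauchy_schwarz x v : dot x v ^+ 2 <= dot x x * dot v v.
Proof.
have [->|v0] := eqVneq v 0; first by rewrite dotC !dot0l mulr0 expr0n.
have := dot_ge0 (dot v v *: x + (- dot x v) *: v).
rewrite !(dotDl, dotDr, dotZl, dotZr) (dotC v x).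
have := dot_gt0 v0; move: (dot v v) (dot x v) (dot x x) => p q r p0.
rewrite [X in 0 <= X](_ : _ = p * (r * p - q ^+ 2)); last by ring.
by rewrite pmulr_rge0// subr_ge0.
Qed.

End RankOne.

(** * Matrix Bernstein inequality for sampling without replacement *)

Section MatrixBernstein.
Context {R : realType} {d : nat} {I : finType}.
Variables (T : {set I}) (v : I -> 'rV[R]_d) (r L : R).
Hypotheses (T0 : (0 < #|T|)%N) (r0 : 0 < r) (L0 : 0 <= L).
Hypothesis v_le : forall j, dot (v j) (v j) <= r.
Hypothesis sum_le : forall x,
  dot (x *m (\sum_(j in T) rank1 (v j))) x <= L * dot x x.

Let m : R := #|T|%:R.
Let s : R := 3 / 4 / r.

Definition mean_rank1 : 'M[R]_d := m^-1 *: \sum_(j in T) rank1 (v j).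

(** The scale [s = 3 / 4 / r] keeps the quadratic form below [3 / 4], the range of
    [expR_le_quadratic]. Since [4 / 3 * s ^+ 2 * r = s], the second-order term then costs at most
    [s * L]. *)
Definition centered j : 'M[R]_d := s *: (rank1 (v j) - mean_rank1).

Let m_gt0 : 0 < m. Proof. by rewrite ltr0n. Qed.
Let s_gt0 : 0 < s. Proof. by rewrite divr_gt0. Qed.

Lemma trmx_mean_rank1 : mean_rank1^T = mean_rank1.
Proof. by rewrite /mean_rank1 linearZ/= trmx_sum_rank1. Qed.

Lemma trmx_centered j : (centered j)^T = centered j.
Proof. by rewrite /centered linearZ/= linearB/= trmx_rank1 trmx_mean_rank1. Qed.

Lemma dot_mean_rank1_ge0 x : 0 <= dot (x *m mean_rank1) x.
Proof.
rewrite /mean_rank1 -scalemxAr dotZl dot_sum_rank1.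
by rewrite mulr_ge0 ?invr_ge0 ?(ltW m_gt0)// sumr_ge0// => j _; rewrite sqr_ge0.
Qed.

Lemma dot_centered_le j x : dot (x *m centered j) x <= 3 / 4 * dot x x.
Proof.
rewrite /centered -scalemxAr dotZl mulmxBr -scaleN1r dotDl dotZl dot_rank1.
apply: (@le_trans _ _ (s * (dot x x * r))).
  rewrite ler_wpM2l ?(ltW s_gt0)//; have := cauchy_schwarz x (v j).
  have := ler_wpM2l (dot_ge0 x) (v_le j); have := dot_mean_rank1_ge0 x; lra.
rewrite le_eqVlt; apply/orP; left; apply/eqP.
by rewrite /s; field; rewrite gt_eqF.
Qed.

Lemma sum_centered : \sum_(j in T) centered j = 0.
Proof.
rewrite -scaler_sumr big_split/= sumrN sumr_const -scaler_nat.
by rewrite /mean_rank1 scalerA divff ?gt_eqF// scale1r subrr scaler0.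
Qed.

(* The variance is at most the second moment, which the bounds on [v] reduce
   to the first moment. *)
Lemma sum_sqr_centered_le x :
  \sum_(j in T) dot (x *m centered j) (x *m centered j) <=
  s * (3 / 4) * (L * dot x x).
Proof.
pose y := x *m mean_rank1; pose w j := x *m rank1 (v j).
have sum_w : \sum_(j in T) w j = m *: y.
  rewrite /w /y /mean_rank1 -mulmx_sumr -scalemxAr scalerA.
  by rewrite divff ?gt_eqF// scale1r.
have E j : dot (x *m centered j) (x *m centered j) =
    s ^+ 2 * (dot (w j) (w j) - 2 * dot (w j) y + dot y y).
  rewrite /centered -scalemxAr mulmxBr -/(w j) -/y -scaleN1r.
  clear sum_w; move: (w j) y => a b.
  by rewrite !(dotZl, dotZr, dotDl, dotDr) (dotC b a); ring.
under eq_bigr do rewrite E.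
rewrite -mulr_sumr !big_split/= sumrN -mulr_sumr -dot_suml sum_w dotZl.
rewrite sumr_const -[_ *+ _]mulr_natl -/m.
have w_le : \sum_(j in T) dot (w j) (w j) <= r * (L * dot x x).
  apply: le_trans (ler_wpM2l (ltW r0) (sum_le x)).
  rewrite dot_sum_rank1 mulr_sumr; apply: ler_sum => j _.
  rewrite /w mul_rank1 dotZl dotZr mulrA -expr2 mulrC.
  by rewrite ler_wpM2r ?sqr_ge0.
have my0 : 0 <= m * dot y y by rewrite mulr_ge0 ?dot_ge0// ltW.
apply: (@le_trans _ _ (s ^+ 2 * (r * (L * dot x x)))).
  by rewrite ler_wpM2l ?sqr_ge0//; lra.
rewrite le_eqVlt; apply/orP; left; apply/eqP.
by rewrite /s; field; rewrite gt_eqF.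
Qed.

(** Golden-Thompson separates [H] from the draw. In the eigenbasis of [H] the linear terms cancel by
    [sum_centered] and the quadratic ones add [s * L]. This is the one-draw hypothesis of the
    sampling argument, with [c = m + s * L]. *)
Lemma trexp_step H : H^T = H ->
  \sum_(j in T) trexp (H + centered j) <= (m + s * L) * trexp H.
Proof.
move=> sH.
apply: (@le_trans _ _ (\sum_(j in T) \sum_i expR (eigval H i) *
   dot (eigvec H i *m mxfun expR (centered j)) (eigvec H i))).
  apply: ler_sum => j _; rewrite -mxtrace_mxfun_mul.
  exact: golden_thompson (trmx_centered j).
rewrite exchange_big/= /trexp mxtrace_mxfun// mulr_sumr.
apply: ler_sum => i _; rewrite -mulr_sumr mulrC ler_wpM2r ?expR_ge0//.
set q := eigvec H i.
have q1 : dot q q = 1 by rewrite dot_eigvec// eqxx.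
apply: (@le_trans _ _ (\sum_(j in T) (dot q q + dot (q *m centered j) q +
    4 / 3 * dot (q *m centered j) (q *m centered j)))).
  apply: ler_sum => j _; apply: dot_mxfun_expR_le; first exact: trmx_centered.
  exact: dot_centered_le.
rewrite !big_split/= [X in _ + X + _](_ : _ = 0) ?addr0; last first.
  by rewrite -dot_suml -mulmx_sumr sum_centered mulmx0 dot0l.
rewrite sumr_const q1 -mulr_sumr lerD2l.
by have := sum_sqr_centered_le q; rewrite q1; lra.
Qed.

(** Here [(1 + s * L / m) ^+ k] is bounded by an exponential, and the dimension [d] enters as
    [trexp 0]. *)
Lemma trexp_subset_sum_le k : (k <= #|T|)%N ->
  \sum_(S : {set I} | (S \subset T) && (#|S| == k))
     trexp (\sum_(j in S) centered j) <=
  'C(#|T|, k)%:R * (expR (k%:R * (s * L / m)) * d%:R).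
Proof.
move=> km.
have sS (S : {set I}) : (\sum_(j in S) centered j)^T = \sum_(j in S) centered j.
  by rewrite linear_sum/=; apply: eq_bigr => j _; rewrite trmx_centered.
have := @subset_sum_le R I 'M[R]_d T centered trexp (m + s * L).
have sub_sym u z : (centered z - centered u)^T = centered z - centered u.
  by rewrite linearB/= !trmx_centered.
have c0 : 0 <= m + s * L.
  by apply: addr_ge0; [exact: ltW|apply: mulr_ge0; [exact: ltW|]].
move/(_ (fun S u z => trexp_midpoint_convex (sS S) (sub_sym u z))
        (fun S => trexp_step (sS S)) k c0 km).
rewrite trexp0 -/m -/(subset_sum T centered trexp k) => le_sum.
rewrite -(@ler_pM2l _ (m ^+ k)) ?exprn_gt0//; apply: (le_trans le_sum).
rewrite [leRHS]mulrCA -[leLHS]mulrA ler_wpM2l// [leRHS]mulrA ler_wpM2r//.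
have -> : m + s * L = m * (1 + s * L / m) by field; rewrite gt_eqF.
rewrite exprMn ler_wpM2l ?exprn_ge0 ?(ltW m_gt0)//; apply: le_exp_expR.
apply: (@le_trans _ _ 0); first lra.
by apply: divr_ge0; [apply: mulr_ge0; [exact: ltW|]|exact: ltW].
Qed.

End MatrixBernstein.

(** * Largest eigenvalues averaged over the subsets containing a fixed index *)

Section SubsetAverage.
Context {R : realType} {d : nat} {I : finType}.
Variables (i : I) (v : I -> 'rV[R]_d) (r L : R) (k : nat).
Hypotheses (d0 : (0 < d)%N) (L0 : 0 <= L).
Hypothesis v_le : forall j, dot (v j) (v j) <= r.
Hypothesis sum_le : forall x, dot (x *m (\sum_j rank1 (v j))) x <= L * dot x x.

Let T := ~: [set i]%SET.
Hypotheses (T0 : (0 < #|T|)%N) (kT : (k <= #|T|)%N).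
Let m : R := #|T|%:R.

(** For [k = b - 1], [m = n - 1] and [L] the largest eigenvalue of the full, unnormalized sum,
    [U / b] times this is the Bernstein bound. *)
Let bound : R := 2 * (k%:R / m * L) + (1 - k%:R / m) * r + 4 / 3 * ln d%:R * r.

Let m_gt0 : 0 < m. Proof. by rewrite ltr0n. Qed.

Let km_le1 : k%:R / m <= 1.
Proof. by rewrite ler_pdivrMr// mul1r ler_nat. Qed.

Let r_ge0 : 0 <= r. Proof. exact: le_trans (dot_ge0 (v i)) (v_le i). Qed.

Let ln_d_ge0 : 0 <= ln d%:R :> R. Proof. by rewrite ln_ge0// ler1n. Qed.

Let sumTE : \sum_(j in T) rank1 (v j) = \sum_j rank1 (v j) - rank1 (v i).
Proof.
rewrite [in RHS](bigD1 i)//= addrC addrK.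
by apply: eq_bigl => j; rewrite !inE.
Qed.

Lemma sum_lambda_max_pos_le : 0 < r ->
  \sum_(S : {set I} | (S \subset T) && (#|S| == k))
    lambda_max (\sum_(j in i |: S) rank1 (v j)) <= 'C(#|T|, k)%:R * bound.
Proof.
move=> r0; pose s : R := 3 / 4 / r.
have s0 : 0 < s by rewrite divr_gt0.
(* [expR c] bounds the mean of [trexp (Z S)]. The tangent bound [y <= c - 1 + expR (y - c)] is
   linear in the potential, so it can be averaged over [S]. *)
pose c : R := ln d%:R + k%:R * (s * L / m).
have [C1 C1E] : exists C1, C1 = (1 - k%:R / m) * r + k%:R / m * L by eexists.
pose Z (S : {set I}) := \sum_(j in S) centered T v r j.
have sumT_le x : dot (x *m (\sum_(j in T) rank1 (v j))) x <= L * dot x x.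
  apply: le_trans (sum_le x).
  rewrite sumTE mulmxBr -scaleN1r dotDl dotZl dot_rank1.
  by have := sqr_ge0 (dot x (v i)); lra.
have one (S : {set I}) : (S \subset T) && (#|S| == k) ->
    lambda_max (\sum_(j in i |: S) rank1 (v j)) <=
    C1 + s^-1 * (c - 1 + expR (- c) * trexp (Z S)).
  case/andP=> ST /eqP Sk.
  have iS : i \notin S.
    by apply/negP => /(fintype.subsetP ST); rewrite !inE eqxx.
  apply: lambda_max_le => // [|x x1]; first exact: trmx_sum_rank1.
  rewrite big_setU1//= mulmxDr dotDl.
  have sZ : (Z S)^T = Z S.
    by rewrite /Z linear_sum/=; apply: eq_bigr => j _; rewrite trmx_centered.
  have := expR_dot_le_trexp sZ x1; set y := dot (x *m Z S) x => y_le.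
  have {y_le} y_le : y <= c - 1 + expR (- c) * trexp (Z S).
    have := ler_wpM2l (expR_ge0 (- c)) y_le; rewrite -expRD.
    by have := expR_ge1Dx (- c + y); lra.
  have ZE : Z S = s *: (\sum_(j in S) rank1 (v j) - k%:R *: mean_rank1 T v).
    rewrite /Z -scaler_sumr big_split/= sumrN sumr_const Sk.
    by rewrite -[_ *+ k]scaler_nat.
  have dotB A B : dot (x *m (A - B)) x = dot (x *m A) x - dot (x *m B) x.
    by rewrite mulmxBr -scaleN1r dotDl dotZl mulN1r.
  have yE : y = s * (dot (x *m (\sum_(j in S) rank1 (v j))) x -
      k%:R * (m^-1 * (dot (x *m (\sum_j rank1 (v j))) x - dot x (v i) ^+ 2))).
    rewrite /y ZE -scalemxAr dotZl dotB /mean_rank1 -/m sumTE scalerA.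
    by rewrite -scalemxAr dotZl dotB dot_rank1 mulrA.
  rewrite dot_rank1; have := cauchy_schwarz x (v i); rewrite x1 mul1r.
  have := sum_le x; rewrite x1 mulr1.
  move: yE; move: (dot (x *m (\sum_(j in S) rank1 (v j))) x) => p.
  move: (dot (x *m (\sum_j rank1 (v j))) x) (dot x (v i) ^+ 2) => A w.
  move=> yE AL /le_trans/(_ (v_le i)) wr.
  (* The mean over the other indices is [(A - w) / m]; taken [k] times it leaves weight [1 - k / m]
     on [w]. *)
  have -> : w + p = (1 - k%:R / m) * w + k%:R / m * A + s^-1 * y.
    by rewrite yE; field; rewrite !gt_eqF.
  rewrite C1E lerD//; last by rewrite ler_wpM2l// invr_ge0 ltW.
  rewrite lerD ?ler_wpM2l// ?subr_ge0// divr_ge0//; exact: ltW.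
apply: (le_trans (ler_sum _ one)).
rewrite big_split/= -mulr_sumr big_split/= -mulr_sumr.
have const_sum (t : R) : \sum_(S : {set I} | (S \subset T) && (#|S| == k)) t =
    'C(#|T|, k)%:R * t.
  rewrite -cards_draws mulr_natl -sumr_const.
  by apply: eq_bigl => S; rewrite inE.
(* The last summand is the bound on the averaged potential, which cancels the [- 1]. What remains,
   [s^-1 * c], is the logarithmic term plus the second copy of [k / m * L]. *)
have -> : 'C(#|T|, k)%:R * bound = 'C(#|T|, k)%:R * C1 +
    s^-1 * ('C(#|T|, k)%:R * (c - 1) + 'C(#|T|, k)%:R).
  by rewrite /bound C1E /c /s; field; rewrite !gt_eqF.
rewrite !const_sum lerD2l. rewrite ler_wpM2l ?invr_ge0 ?(ltW s0)// lerD2l.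
have := trexp_subset_sum_le T0 r0 L0 v_le sumT_le kT.
move=> /(ler_wpM2l (expR_ge0 (- c)))/le_trans; apply.
have ecE : expR c = expR (k%:R * (s * L / m)) * d%:R.
  by rewrite /c addrC expRD lnK// posrE ltr0n.
by rewrite -/s -/m mulrCA -ecE [expR (- c) * _]mulrC expRxMexpNx_1 mulr1.
Qed.

(** The scale [s] divides by [r]; if [r] is not positive, all [v j] vanish. *)
Lemma sum_lambda_max_le :
  \sum_(S : {set I} | (S \subset T) && (#|S| == k))
    lambda_max (\sum_(j in i |: S) rank1 (v j)) <= 'C(#|T|, k)%:R * bound.
Proof.
have [r0|r0] := ltP 0 r; first exact: sum_lambda_max_pos_le.
have v0 j : v j = 0.
  by apply/eqP; rewrite -dot_eq0 eq_le dot_ge0 (le_trans (v_le j)).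
apply: (@le_trans _ _ 0).
  apply: sumr_le0 => S _; apply: lambda_max_le => // [|x _].
    exact: trmx_sum_rank1.
  by rewrite dot_sum_rank1 big1// => j _; rewrite v0 dotC dot0l expr0n.
rewrite mulr_ge0// /bound !addr_ge0// !mulr_ge0// ?subr_ge0//.
by rewrite invr_ge0 ltW.
Qed.

End SubsetAverage.

(** * Smoothness constants in terms of rank-one sums *)

Section ExpectedSmoothness.
Context {R : realType} {n d : nat}.
Variables (a : 'I_n -> 'cV[R]_d) (U : R).
Hypotheses (d0 : (0 < d)%N) (U0 : 0 <= U).

Let v j := (a j)^T.

Lemma lambda_max_rank1_ge0 (B : {set 'I_n}) :
  0 <= lambda_max (\sum_(j in B) rank1 (v j)).
Proof.
have s0 : (0 : 'M[R]_d)^T = 0 by rewrite trmx0.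
pose x := eigvec (0 : 'M[R]_d) (Ordinal d0).
have := dot_le_lambda_max x (trmx_sum_rank1 (index_enum _) (mem B) v).
rewrite [dot x x]dot_eigvec// eqxx mulr1; apply: le_trans.
by rewrite dot_sum_rank1 sumr_ge0// => j _; rewrite sqr_ge0.
Qed.

Lemma subsample_smoothnessE (B : {set 'I_n}) : subsample_smoothness a U B =
  U / #|B|%:R * lambda_max (\sum_(j in B) rank1 (v j)).
Proof.
rewrite /subsample_smoothness; congr (_ * lambda_max _).
by apply: eq_bigr => j _; rewrite /rank1 /v trmxK.
Qed.

Lemma max_smoothnessE :
  max_smoothness a U = U * \big[Num.max/0]_j lambda_max (rank1 (v j)).
Proof.
rewrite (big_morph (fun x => U * x) (fun x y => maxr_pMr x y U0) (mulr0 U)).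
apply: eq_bigr => j _.
by rewrite subsample_smoothnessE finset.big_set1 cards1 divr1.
Qed.

(** The Rayleigh quotient of [rank1 (v j)] at [v j] itself is the squared norm of [v j]. *)
Lemma dot_le_max_lambda j :
  dot (v j) (v j) <= \big[Num.max/0]_j lambda_max (rank1 (v j)).
Proof.
apply: le_trans (le_bigmax _ _ j) => /=.
have [vj0|vj0] := eqVneq (v j) 0.
  have := lambda_max_rank1_ge0 [set j]%SET; rewrite finset.big_set1.
  by rewrite [dot _ _](_ : _ = 0)// vj0 dot0l.
have := dot_le_lambda_max (v j) (trmx_rank1 (v j)); rewrite dot_rank1 expr2.
by rewrite ler_pM2r// dot_gt0.
Qed.

Lemma reindex_setU1 (F : {set 'I_n} -> R) (i : 'I_n) k :
  \sum_(B : {set 'I_n} | (#|B| == k.+1) && (i \in B)) F B =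
  \sum_(S : {set 'I_n} | (S \subset ~: [set i]%SET) && (#|S| == k))
    F (i |: S)%SET.
Proof.
rewrite (reindex_onto (fun S => i |: S)%SET (fun B => B :\ i)%SET) /=;
  last first.
  by move=> B /andP[_ iB]; rewrite finset.setD1K.
apply: eq_bigl => S.
have -> : (S \subset ~: [set i]%SET) = (i \notin S).
  by rewrite finset.subsetC finset.sub1set inE.
rewrite cardsU1 finset.setU11 andbT.
have [iS|iS] := boolP (i \in S); last by rewrite finset.setU1K// eqxx andbT.
apply/negP => /andP[_ /eqP SE]; move: iS; rewrite -SE.
by rewrite !inE eqxx.
Qed.

End ExpectedSmoothness.

Theorem theorem3 (R : realType) (n d : nat) (hn : (2 <= n)%N) (hd : (1 <= d)%N)
    (a : 'I_n -> 'cV[R]_d) (U : R) (hU : 0 <= U)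
    (b : nat) (hb1 : (1 <= b)%N) (hbn : (b <= n)%N) :
  expected_smoothness a U b <= bernstein_bound a U b.
Proof.
case: n hn a hbn => // m m0 a; case: b hb1 => // k _ km.
have C0 : 0 < 'C(m, k)%:R :> R by rewrite ltr0n bin_gt0.
suff le_i i : \sum_(B : {set 'I_m.+1} | (#|B| == k.+1) && (i \in B))
    subsample_smoothness a U B <= 'C(m, k)%:R * bernstein_bound a U k.+1.
  rewrite /expected_smoothness/= ler_pdivrMl// bigmax_le//.
  (* The default [0] of the maximum must obey the bound too; it lies below the nonnegative sum for
     [ord0]. *)
  apply: le_trans (le_i ord0); apply: sumr_ge0 => B _.
  by rewrite subsample_smoothnessE mulr_ge0 ?divr_ge0 ?lambda_max_rank1_ge0.
rewrite (eq_bigr (fun B : {set 'I_m.+1} => U / k.+1%:R *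
    lambda_max (\sum_(j in B) rank1 (a j)^T))); last first.
  by move=> B /andP[/eqP Bk _]; rewrite subsample_smoothnessE Bk.
rewrite reindex_setU1 -mulr_sumr.
set r := \big[Num.max/0]_j lambda_max (rank1 (a j)^T).
set L := lambda_max (\sum_(j in [set: 'I_m.+1]%SET) rank1 (a j)^T).
have cardT : #|~: [set i]%SET| = m by rewrite cardsC1 card_ord.
have sum_le x : dot (x *m (\sum_j rank1 (a j)^T)) x <= L * dot x x.
  rewrite (eq_bigl (mem [set: 'I_m.+1]%SET)); last first.
    by move=> j; rewrite /= finset.in_setT.
  exact/dot_le_lambda_max/trmx_sum_rank1.
have := @sum_lambda_max_le R d 'I_m.+1 i (fun j => (a j)^T) r L k hd.
rewrite cardT => /(_ (lambda_max_rank1_ge0 _ hd _)).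
move=> /(_ (dot_le_max_lambda _ hd) sum_le m0 km).
have Uk0 : 0 <= U / k.+1%:R by rewrite divr_ge0.
move=> /(ler_wpM2l Uk0)/le_trans; apply.
(* Only an identity is left: the factor [n] in the bound cancels the [1 / n] in
   [full_smoothness]. *)
rewrite le_eqVlt; apply/orP; left; apply/eqP.
rewrite /bernstein_bound max_smoothnessE// -/r /full_smoothness.
rewrite subsample_smoothnessE -/L cardsT card_ord -!natr1.
have m0' : m%:R != 0 :> R by rewrite pnatr_eq0 -lt0n.
have k1 : k%:R + 1 != 0 :> R by rewrite natr1 pnatr_eq0.
have m1 : m%:R + 1 != 0 :> R by rewrite natr1 pnatr_eq0.
by field; rewrite addrK m0' k1 m1.
Qed.
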